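(* Let $G$ be a connected graph of order $n(G)$ with radius $\mathrm{rad}(G)=r$. Then $$\xi^d(G)\ge\Big(n(G)-1+\binom{r}{2}\Big)\varepsilon(G).$$ Equality holds if and only if $G$ is a complete graph or a cocktail-party graph.
   Context: All graphs are finite, simple and connected. For a vertex $v$: $\varepsilon(v)=\max_u d(v,u)$ is its eccentricity and $D(v)=\sum_u d(v,u)$ its total distance ($d$ the shortest-path distance). $\xi^d(G)=\sum_v\varepsilon(v)D(v)$, $\varepsilon(G)=\sum_v\varepsilon(v)$, and $\mathrm{rad}(G)=\min_v\varepsilon(v)$. A cocktail-party graph $CP_{2k}$ ($k\ge2$) is obtained from the complete graph $K_{2k}$ by removing a perfect matching. *)

(* Defs.v *)
From mathcomp Require Import all_boot.

Set Implicit Arguments.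
Unset Strict Implicit.
Unset Printing Implicit Defensive.

(* A finite simple graph is a symmetric irreflexive adjacency relation       *)
(* [e : rel T] on a finite type [T] of vertices; its order is [#|T|].        *)

Definition connected_graph (T : finType) (e : rel T) : Prop :=
  0 < #|T| /\ forall x y : T, connect e x y.

Definition has_path_of_length (T : finType) (e : rel T) (x y : T) (n : nat)
  : bool :=
  [exists p : n.-tuple T, [&& path e x p, last x p == y & uniq (x :: p)]].

(* A path without repeated vertices has length less than [#|T|], so the      *)
(* minimum ranges over all paths from [x] to [y]; the default [#|T|] is only *)
(* reached when there is none.                                               *)
Definition gdist (T : finType) (e : rel T) (x y : T) : nat :=
  \big[minn/#|T|]_(n < #|T| | has_path_of_length e x y n) n.

Definition ecc (T : finType) (e : rel T) (v : T) : nat :=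
  \max_(u : T) gdist e v u.

Definition total_dist (T : finType) (e : rel T) (v : T) : nat :=
  \sum_(u : T) gdist e v u.

Definition ecc_dist_sum (T : finType) (e : rel T) : nat :=
  \sum_(v : T) ecc e v * total_dist e v.

Definition total_ecc (T : finType) (e : rel T) : nat :=
  \sum_(v : T) ecc e v.

(* In a connected graph all eccentricities are less than [#|T|], so the      *)
(* default value of the minimum plays no role.                               *)
Definition radius (T : finType) (e : rel T) : nat :=
  \big[minn/#|T|]_(v : T) ecc e v.

Definition complete_rel (T : finType) : rel T := fun x y => x != y.

Definition is_complete (T : finType) (e : rel T) : Prop :=
  e =2 @complete_rel T.

Definition perfect_matching (T : finType) (e : rel T) (M : {set {set T}})
  : Prop :=
  partition M [set: T] /\
  forall B : {set T}, B \in M -> exists x y : T, e x y /\ B = [set x; y].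

Definition is_cocktail_party (T : finType) (e : rel T) : Prop :=
  exists k : nat, 2 <= k /\ #|T| = 2 * k /\
  exists M : {set {set T}},
    perfect_matching (@complete_rel T) M /\
    e =2 (fun x y => complete_rel x y && ([set x; y] \notin M)).

(* Main.v *)
Require Import Defs.
From mathcomp Require Import all_boot.

(* A vertex [v] of eccentricity [k] has a vertex at each distance [1, ..., k], so
   [D(v) >= n - 1 + C(k, 2) >= n - 1 + C(r, 2)]; weighting by the eccentricities
   and summing gives the bound.  Equality forces (unless [r = 0]) every eccentricity
   to be [r] and every distance level of [v] beyond the first to be a singleton.
   If [r >= 3], a common neighbour of [v] and of the only vertex at distance 2 from
   [v] would have eccentricity less than [r].  If [r = 2], each vertex has exactly
   one non-neighbour, and these pairs form the removed perfect matching. *)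

(** * Minima with a default value *)

Lemma bigminn_leq {I : finType} {P : pred I} {F : I -> nat} {x0} j :
  P j -> \big[minn/x0]_(i | P i) F i <= F j.
Proof.
move=> Pj; have := mem_index_enum j.
elim: (index_enum I) => // i s IHs; rewrite inE big_cons => /predU1P[<-|/IHs le_j].
  by rewrite Pj geq_minl.
by case: ifP => _ //; rewrite geq_min le_j orbT.
Qed.

(** [minn] has no neutral element on [nat], so the default [x0] may itself be the minimum and forms
    a separate case. *)
Lemma bigminn_default_or_attained {I : finType} (P : pred I) (F : I -> nat) x0 :
  \big[minn/x0]_(i | P i) F i = x0
  \/ exists2 j, P j & \big[minn/x0]_(i | P i) F i = F j.
Proof.
apply: (big_ind (fun m => m = x0 \/ exists2 j, P j & m = F j)) => [|m n Hm Hn|j Pj].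
- by left.
- by case: (leqP m n).
- by right; exists j.
Qed.

(** * Shortest-path distance *)

Section Distance.

Variables (T : finType) (e : rel T).

(** Cutting the loops out of a walk leaves a duplicate-free path with fewer than [#|T|] edges, hence
    a candidate in the minimum. *)
Lemma gdist_leq_size {x : T} {p : seq T} :
  path e x p -> gdist e x (last x p) <= size p.
Proof.
move=> pth; case/shortenP: pth => q pth_q uq sub_q.
have lt_q : size q < #|T|.
  by rewrite -[(size q).+1]/(size (x :: q)) -(card_uniqP uq) max_card.
have le_qp : size q <= size p by case/andP: uq => _ /uniq_leq_size; apply.
apply: leq_trans le_qp; apply: (bigminn_leq (Ordinal lt_q)).
by apply/existsP; exists (in_tuple q); rewrite pth_q uq eqxx.
Qed.

Lemma gdist_geodesic (x y : T) : connect e x y ->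
  exists p, [/\ path e x p, last x p = y & size p = gdist e x y].
Proof.
move=> /connectP[p pth_p ->]; rewrite /gdist.
case/shortenP: pth_p => q pth_q uq _.
case: (bigminn_default_or_attained
  (fun n : 'I_#|T| => has_path_of_length e x (last x q) n) (@nat_of_ord _) #|T|).
  (* The default [#|T|] is excluded, since the duplicate-free [q] has fewer edges. *)
  move=> dT; have := gdist_leq_size pth_q; rewrite /gdist dT leqNgt.
  by rewrite -[(size q).+1]/(size (x :: q)) -(card_uniqP uq) max_card.
case=> n /existsP[t /and3P[pth_t /eqP last_t _]] ->.
by exists t; rewrite size_tuple.
Qed.

Hypothesis e_conn : forall x y : T, connect e x y.

Lemma gdist_xx (x : T) : gdist e x x = 0.
Proof. by apply/eqP; rewrite -leqn0 (@gdist_leq_size x [::]). Qed.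

Lemma gdist_eq0 (x y : T) : (gdist e x y == 0) = (x == y).
Proof.
apply/eqP/eqP => [d0|->]; last exact: gdist_xx.
have [p [_ last_p]] := gdist_geodesic _ _ (e_conn x y).
by rewrite d0 => /size0nil p_nil; rewrite -last_p p_nil.
Qed.

Lemma gdist_edge (x y : T) : e x y -> gdist e x y <= 1.
Proof. by move=> exy; apply: (@gdist_leq_size x [:: y]); rewrite /= exy. Qed.

Lemma gdist_leq1 (x y : T) : (gdist e x y <= 1) = (x == y) || e x y.
Proof.
apply/idP/orP => [|[/eqP->|/gdist_edge//]]; last by rewrite gdist_xx.
have [p [pth_p last_p <-]] := gdist_geodesic _ _ (e_conn x y).
case: p pth_p last_p => [_ <-|z [|? ?] //= /andP[exz _] <- _]; by [left | right].
Qed.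

Lemma gdist_triangle (x y z : T) : gdist e x z <= gdist e x y + gdist e y z.
Proof.
have [p [pth_p last_p <-]] := gdist_geodesic _ _ (e_conn x y).
have [q [pth_q last_q <-]] := gdist_geodesic _ _ (e_conn y z).
rewrite -size_cat -last_q -last_p -last_cat gdist_leq_size //.
by rewrite cat_path pth_p last_p.
Qed.

(** A geodesic cut after [j] edges bounds both distances from above; the triangle inequality makes
    both bounds sharp. *)
Lemma gdist_between {x y : T} {j : nat} : j <= gdist e x y ->
  exists z, gdist e x z = j /\ gdist e z y = gdist e x y - j.
Proof.
have [p [pth_p last_p sz_p]] := gdist_geodesic _ _ (e_conn x y) => le_j.
exists (last x (take j p)); set z := last _ _.
have: path e x (take j p ++ drop j p) by rewrite cat_take_drop.
rewrite cat_path => /andP[/gdist_leq_size + /gdist_leq_size].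
rewrite -last_cat cat_take_drop last_p size_drop size_takel ?sz_p // -/z.
move=> le1 le2; have tri := gdist_triangle x z y.
have ge1 : j <= gdist e x z.
  by rewrite -(leq_add2r (gdist e x y - j)) subnKC // (leq_trans tri) ?leq_add2l.
split; apply/eqP; rewrite eqn_leq ?le1 ?le2 //=.
by rewrite leq_subLR (leq_trans tri) ?leq_add2r.
Qed.

(** * Eccentricity, radius and total distance *)

Lemma gdist_leq_ecc (v u : T) : gdist e v u <= ecc e v.
Proof. exact: (leq_bigmax u). Qed.

Lemma ecc_attained (v : T) : exists u, gdist e v u = ecc e v.
Proof.
have T_gt0 : 0 < #|T| by apply/card_gt0P; exists v.
by have [u ecc_u] := eq_bigmax (gdist e v) T_gt0; exists u.
Qed.

Lemma radius_leq_ecc (v : T) : radius e <= ecc e v.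
Proof. exact: bigminn_leq. Qed.

Lemma total_dist_excess (v : T) :
  total_dist e v = #|T| - 1 + \sum_(u : T) (gdist e v u).-1.
Proof.
have -> : #|T| - 1 = \sum_(u : T) (u != v).
  by rewrite -big_mkcond /= sum1_card subn1 -(cardC1 v).
rewrite -big_split; apply: eq_bigr => u _ /=.
by rewrite eq_sym -gdist_eq0 -lt0n; case: gdist.
Qed.

(** [f] picks one vertex per distance; for distances 1, 2, ... the excesses 0, 1, ..., [ecc e v - 1]
    add up to the binomial. The exact remainder is kept for the equality case. *)
Lemma total_dist_levels (v : T) : exists f : 'I_(ecc e v).+1 -> T,
  (forall i, gdist e v (f i) = i) /\
  total_dist e v = #|T| - 1 + 'C(ecc e v, 2)
                   + \sum_(u | u \notin codom f) (gdist e v u).-1.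
Proof.
have [y d_y] := ecc_attained v.
have ex_z (i : 'I_(ecc e v).+1) : exists z, gdist e v z == i.
  have le_i : i <= gdist e v y by rewrite d_y -ltnS.
  by have [z [/eqP dz _]] := gdist_between le_i; exists z.
pose f i := xchoose (ex_z i).
have df i : gdist e v (f i) = i by apply/eqP/(xchooseP (ex_z i)).
exists f; split=> //; rewrite total_dist_excess -addnA; congr (_ + _).
rewrite (bigID (fun u => u \in codom f)) /=; congr (_ + _).
have f_inj : injective f by move=> i j eq_f; apply/val_inj; rewrite /= -!df eq_f.
rewrite -(big_uniq (codom f)); last exact/injectiveP.
rewrite big_image /=; under eq_bigr do rewrite df.
by rewrite big_ord_recl /= add0n -bin2_sum big_mkord;
  apply: eq_bigr => i _; rewrite add0n.
Qed.

Lemma total_dist_geq (v : T) : #|T| - 1 + 'C(radius e, 2) <= total_dist e v.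
Proof.
have [f [_ ->]] := total_dist_levels v.
by rewrite -addnA leq_add2l (leq_trans _ (leq_addr _ _)) // leq_bin2l ?radius_leq_ecc.
Qed.

(** Both slacks of the lower bound must vanish: the gap between the two binomials, and the excess
    outside the chosen vertices. *)
Lemma minimal_total_dist (v : T) : 0 < radius e ->
    total_dist e v = #|T| - 1 + 'C(radius e, 2) ->
  ecc e v = radius e /\
  forall u w, 1 < gdist e v u -> gdist e v u = gdist e v w -> u = w.
Proof.
have [f [df ->]] := total_dist_levels v; move=> rad_gt0 /eqP.
have le_bin : 'C(radius e, 2) <= 'C(ecc e v, 2) by rewrite leq_bin2l ?radius_leq_ecc.
rewrite -addnA eqn_add2l => /eqP def_bin.
have bin_eq : 'C(ecc e v, 2) = 'C(radius e, 2).
  by apply/eqP; rewrite eqn_leq le_bin andbT -def_bin leq_addr.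
have /eqP : \sum_(u | u \notin codom f) (gdist e v u).-1 = 0.
  by apply/eqP; rewrite -(eqn_add2l ('C(ecc e v, 2))) def_bin bin_eq addn0.
rewrite sum_nat_eq0 => /forall_inP near_u.
have far_codom u : 1 < gdist e v u -> u \in codom f.
  move=> d_gt1; apply/contraT => /near_u.
  by case: gdist d_gt1 => [|[|]].
split=> [|u w d_gt1 d_uw].
  apply/eqP; rewrite eq_sym eqn_leq radius_leq_ecc leqNgt /=; apply/negP.
  (* With [r] the radius, ['C(r + 1, 2)] exceeds ['C(r, 2)] by [r], which is positive. *)
  move/(leq_bin2l 2); rewrite bin_eq binS bin1.
  by rewrite -[leqRHS]addn0 leq_add2l leqNgt rad_gt0.
have /far_codom/codomP[j def_w] : 1 < gdist e v w by rewrite -d_uw.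
have /codomP[i def_u] := far_codom u d_gt1.
by move: d_uw; rewrite def_u def_w !df => /ord_inj->.
Qed.

(* A vertex [y] adjacent to both [v] and the only vertex at distance 2 from [v]
   lies on a geodesic from [v] to every vertex at distance at least 2. *)
Lemma ecc_decreases (v : T) : 2 < ecc e v -> symmetric e ->
    (forall u w, gdist e v u = 2 -> gdist e v w = 2 -> u = w) ->
  exists y, ecc e y < ecc e v.
Proof.
move=> ecc_gt2 e_sym uniq2; have [z dz] := ecc_attained v.
have [x [dx _]] : exists x, gdist e v x = 2 /\ gdist e x z = gdist e v z - 2.
  by apply: gdist_between; rewrite dz ltnW.
have [y [dvy dyx]] : exists y, gdist e v y = 1 /\ gdist e y x = gdist e v x - 1.
  by apply: gdist_between; rewrite dx.
rewrite dx in dyx.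
have e_yv : e y v.
  rewrite e_sym; have : gdist e v y <= 1 by rewrite dvy.
  by rewrite gdist_leq1 -gdist_eq0 dvy.
exists y; rewrite -(ltn_predK ecc_gt2) ltnS; apply/bigmax_leqP => w _.
have [le_w | gt_w] := leqP (gdist e v w) 1.
  (* Going through [v] costs at most 2, below [ecc e v]. *)
  rewrite (leq_trans (gdist_triangle y v w)) // -ltnS (ltn_predK ecc_gt2).
  by rewrite (leq_ltn_trans _ ecc_gt2) // (leq_add (gdist_edge _ _ e_yv)).
have [x' [/uniq2/(_ dx)-> dxw]] := gdist_between gt_w.
rewrite (leq_trans (gdist_triangle y x w)) // dyx dxw addnBA // add1n subSS subn1.
by rewrite -!subn1 leq_sub2r ?gdist_leq_ecc.
Qed.

(** * Complete and cocktail-party graphs, and the equality case *)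

Lemma is_complete_total_dist (v : T) : is_complete e -> total_dist e v = #|T| - 1.
Proof.
move=> e_compl; rewrite total_dist_excess big1 ?addn0 // => u _.
have : gdist e v u <= 1 by rewrite gdist_leq1 e_compl /complete_rel; case: eqP.
by case: gdist => [|[|]].
Qed.

(** A perfect matching amounts to the fixed-point-free involution [m] swapping partners; as the
    order is even, [2 < #|T|] means [2 <= k]. *)
Lemma is_cocktail_partyP : is_cocktail_party e <->
  2 < #|T| /\ exists m : T -> T,
    [/\ involutive m, forall v, m v != v & forall u v, e u v = (u != v) && (v != m u)].
Proof.
split=> [[k [k_ge2 [cardT [M [[partM matchM] eE]]]]] | [T_gt2 [m [mK m_neq eE]]]].
  split; first by rewrite cardT (leq_trans (_ : 2 < 2 * 2)) ?leq_mul2l.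
  have /and3P[/eqP coverM trivM _] := partM.
  have ex_m v : exists u, (u != v) && ([set v; u] \in M).
    have vM : v \in cover M by rewrite coverM inE.
    have [x [y [+ defB]]] := matchM _ (pblock_mem vM); rewrite /complete_rel => neq_xy.
    have := pblock_mem vM; move: vM; rewrite -mem_pblock defB !inE => /orP[]/eqP-> BM.
      by exists y; rewrite BM eq_sym neq_xy.
    by exists x; rewrite setUC BM neq_xy.
  pose m v := xchoose (ex_m v).
  have /all_and2[m_neq mM] v : (m v != v) /\ [set v; m v] \in M.
    exact/andP/(xchooseP (ex_m v)).
  (* Blocks are disjoint, so partners are unique; this makes [m] an involution. *)
  have m_uniq u v : u != v -> [set u; v] \in M -> v = m u.
    move=> neq_uv uvM; have : v \in [set u; m u].
      rewrite -(def_pblock trivM (mM u) (set21 _ _)).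
      by rewrite (def_pblock trivM uvM (set21 _ _)) set22.
    by rewrite !inE eq_sym (negPf neq_uv) => /eqP.
  exists m; split=> // [v | u v].
    by apply/esym/m_uniq; rewrite 1?setUC.
  rewrite eE /complete_rel; have [//|/= neq_uv] := eqVneq.
  by congr (~~ _); apply/idP/eqP => [/(m_uniq _ _ neq_uv) | ->].
(* Conversely, the orbits of [m] are the blocks of the matching. *)
pose M := [set [set x; m x] | x in T].
have blockE z x : z \in [set x; m x] -> [set x; m x] = [set z; m z].
  by rewrite !inE => /orP[]/eqP-> //; rewrite mK setUC.
have partM : partition M [set: T].
  apply/and3P; split.
  - rewrite eqEsubset subsetT /=; apply/subsetP => x _.
    by apply/bigcupP; exists [set x; m x]; [apply: imset_f | apply: set21].
  - apply/trivIsetP => _ _ /imsetP[x _ ->] /imsetP[y _ ->]; apply: contraR.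
    by rewrite -setI_eq0 => /set0Pn[z /setIP[/blockE-> /blockE->]].
  - by apply/imsetP => -[x _ /setP/(_ x)]; rewrite !inE eqxx.
have cardT : #|T| = #|M| * 2.
  rewrite -cardsT; apply: card_uniform_partition partM => _ /imsetP[x _ ->].
  by rewrite cards2 eq_sym m_neq.
exists #|M|; rewrite mulnC; split; last split=> //.
  by move: T_gt2; rewrite cardT; case: #|M| => [|[|]].
exists M; split=> [|u v].
  split=> // _ /imsetP[x _ ->]; exists x, (m x).
  by rewrite /complete_rel eq_sym m_neq.
rewrite eE /complete_rel; have [//|/= neq_uv] := eqVneq.
congr (~~ _); apply/eqP/imsetP => [-> | [x _ /setP eq_uv]]; first by exists u.
have /blockE def_u : u \in [set x; m x] by rewrite -eq_uv set21.
have := eq_uv v; rewrite set22 def_u !inE eq_sym (negPf neq_uv).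
by move/esym/eqP.
Qed.

(** Only [m v] is farther than 1 from [v], at distance 2, so the total excess is 1; the general
    lower bound gives the other inequality. *)
Lemma cocktail_party_total_dist (v : T) : is_cocktail_party e ->
  total_dist e v = #|T| - 1 + 'C(radius e, 2).
Proof.
move=> /is_cocktail_partyP[T_gt2 [m [mK m_neq eE]]].
have d_gt1 u w : (1 < gdist e u w) = (w == m u).
  rewrite ltnNge gdist_leq1 eE; have [<-|] //= := eqVneq.
    by rewrite eq_sym (negPf (m_neq u)).
  by rewrite negbK.
have d_m u : gdist e u (m u) = 2.
  apply/eqP; rewrite eqn_leq d_gt1 eqxx andbT.
  (* A third vertex [w] is adjacent to both [u] and [m u]. *)
  have /set0Pn[w] : ~: [set u; m u] != set0.
    rewrite -card_gt0 -(ltn_add2l #|[set u; m u]|) cardsC addn0 cards2.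
    by rewrite (leq_trans _ T_gt2) // ltnS; case: (_ != _).
  rewrite !inE negb_or => /andP[w_u w_mu].
  rewrite (leq_trans (gdist_triangle u w (m u))) //.
  apply: (@leq_add _ _ 1 1); apply: gdist_edge; rewrite eE w_mu ?andbT 1?eq_sym //=.
  by rewrite (inj_eq (can_inj mK)).
apply/eqP; rewrite eqn_leq total_dist_geq andbT total_dist_excess leq_add2l.
rewrite (bigD1 (m v)) //= d_m big1 ?addn0 => [|u neq_u].
  (* The excess 1 of [m v] equals ['C(2, 2)]. *)
  suffices: 2 <= radius e by move/(leq_bin2l 2).
  rewrite /radius; case: (bigminn_default_or_attained predT (ecc e) #|T|) => [->|[u _ ->]].
    exact: ltnW.
  by rewrite -(d_m u) gdist_leq_ecc.
have : ~~ (1 < gdist e v u) by rewrite d_gt1.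
by case: gdist => [|[|]].
Qed.

(** The factor [ecc e v] comes from comparing the sums term by term; it can be cancelled once
    eccentricity 0, a single vertex, is set apart. *)
Lemma minimal_total_dist_cases : symmetric e -> irreflexive e ->
    (forall v, ecc e v * total_dist e v = ecc e v * (#|T| - 1 + 'C(radius e, 2))) ->
  is_complete e \/ is_cocktail_party e.
Proof.
move=> e_sym e_irr min_ecc.
have [/existsP[v ecc0] | ecc_neq0] := boolP [exists v, ecc e v == 0].
  have v_only u : u = v.
    by apply/esym/eqP; rewrite -gdist_eq0 -leqn0 -(eqP ecc0) gdist_leq_ecc.
  by left=> x y; rewrite /complete_rel (v_only x) (v_only y) e_irr eqxx.
have [/existsP[v0 _] | T0] := boolP [exists v : T, true]; last first.
  by left=> x; case/existsP: T0; exists x.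
have ecc_gt0 v : 0 < ecc e v.
  by rewrite lt0n; apply: contraNneq ecc_neq0 => ecc0; apply/existsP; exists v; apply/eqP.
have rad_gt0 : 0 < radius e.
  rewrite /radius; case: (bigminn_default_or_attained predT (ecc e) #|T|) => [->|[u _ ->]] //.
  by apply/card_gt0P; exists v0.
have /all_and2[eccE level_uniq] v : ecc e v = radius e /\
    forall u w, 1 < gdist e v u -> gdist e v u = gdist e v w -> u = w.
  apply: minimal_total_dist => //; apply/eqP.
  by rewrite -(eqn_pmul2l (ecc_gt0 v)) min_ecc.
have d_leq v u : gdist e v u <= radius e by rewrite -(eccE v) gdist_leq_ecc.
have [rad_gt2 | rad_le2] := ltnP 2 (radius e).
  (* A smaller eccentricity contradicts [eccE], by which all are equal. *)
  have [|//|u w du dw|y] := ecc_decreases v0; first by rewrite eccE.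
    by apply: (level_uniq v0); rewrite du.
  by rewrite !eccE ltnn.
have [rad2 | rad_neq2] := eqVneq (radius e) 2; last first.
  have rad1 : radius e <= 1 by rewrite -ltnS ltn_neqAle rad_neq2.
  left=> x y; have := leq_trans (d_leq x y) rad1; rewrite gdist_leq1 /complete_rel.
  by have [->|] := eqVneq; rewrite ?e_irr.
right; apply/is_cocktail_partyP.
have ex_m v : exists u, gdist e v u == 2.
  by have [u du] := ecc_attained v; exists u; rewrite du eccE rad2.
pose m v := xchoose (ex_m v).
have d_m v : gdist e v (m v) = 2 by apply/eqP/(xchooseP (ex_m v)).
have m_neq v : m v != v by rewrite eq_sym -gdist_eq0 d_m.
have eE u v : e u v = (u != v) && (v != m u).
  have [<-|neq_uv] /= := eqVneq; first exact: e_irr.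
  have -> : e u v = (gdist e u v <= 1) by rewrite gdist_leq1 (negPf neq_uv).
  rewrite leqNgt; congr (~~ _); apply/idP/eqP => [d_gt1 | ->]; last by rewrite d_m.
  apply: (level_uniq u) => //; rewrite d_m.
  by apply/eqP; rewrite eqn_leq d_gt1 -rad2 d_leq.
(* By symmetry of [e], [m v] is not adjacent to [v], so [v] is the partner of [m v]. *)
have mK : involutive m.
  move=> v; apply/esym/eqP; have := eE (m v) v.
  by rewrite e_sym eE m_neq eqxx andbF => /esym/negbFE.
split; last by exists m.
(* The midpoint of a geodesic from [v0] to [m v0] is the third vertex. *)
have [z [dz _]] : exists z, gdist e v0 z = 1 /\ gdist e z (m v0) = gdist e v0 (m v0) - 1.
  by apply: gdist_between; rewrite d_m.
have /card_uniqP card3 : uniq [:: v0; m v0; z]; last first.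
  by have := max_card (mem [:: v0; m v0; z]); rewrite card3.
rewrite /= !inE negb_or eq_sym m_neq -gdist_eq0 dz andbT /=.
by apply/eqP => m_z; have := d_m v0; rewrite m_z dz.
Qed.

End Distance.

Theorem theorem4p3 (T : finType) (e : rel T) (r : nat)
  (e_sym : symmetric e) (e_irr : irreflexive e)
  (e_conn : connected_graph e) (rad_e : radius e = r) :
  (#|T| - 1 + 'C(r, 2)) * total_ecc e <= ecc_dist_sum e
  /\
  (ecc_dist_sum e = (#|T| - 1 + 'C(r, 2)) * total_ecc e
   <-> is_complete e \/ is_cocktail_party e).
Proof.
case: e_conn => _ {}e_conn; rewrite -{r}rad_e mulnC big_distrl /=.
have term_leq v :
    ecc e v * (#|T| - 1 + 'C(radius e, 2)) <= ecc e v * total_dist e v.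
  by rewrite leq_mul2l total_dist_geq ?orbT.
(* Equality of the sums is equivalent to equality in every term. *)
have [le_sum eq_sum] := leqif_sum (fun v (_ : true) => leqif_eq (term_leq v)).
split=> //; split=> [sum_eq | e_cases].
  apply: minimal_total_dist_cases => // v; apply/esym/eqP.
  by move: eq_sum; rewrite -sum_eq eqxx => /esym/forall_inP; apply.
apply: eq_bigr => v _; congr (_ * _).
case: e_cases => [e_compl | /cocktail_party_total_dist-> //].
(* The value [#|T| - 1] is squeezed against the lower bound, without computing the radius. *)
apply/eqP; rewrite eqn_leq total_dist_geq // andbT is_complete_total_dist //.
exact: leq_addr.
Qed.
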